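(* Let $p$ be a prime, let $d\ge2$ be an integer with $p>d$, and write $p=d\omega+a$ with integers $\omega\ge1$ and $1\le a<d$. Let $\mathbb{L}$ be a perfect field of characteristic $p$, $R=\mathbb{L}[x_1,\dots,x_d]$, $\mathfrak m=(x_1,\dots,x_d)$, and let $f=u_1x_1^d+\cdots+u_dx_d^d$ with all $u_i\in\mathbb{L}^{\ast}=\mathbb{L}\setminus\{0\}$. If $a=1$, then $\operatorname{fpt}_{\mathfrak m}(f)=1$. If $a\ge2$, then: (1) if $p<a(d-1)$, then \[\operatorname{fpt}_{\mathfrak m}(f)<\frac{(d+1)\omega+\lceil 2a/d\rceil}{p}\le 1,\] and the numbers $\operatorname{fpt}_{\mathfrak m}(f)$, $\frac{(d+1)\omega+\lceil 2a/d\rceil}{p}$ and $1$ are $F$-jumping numbers of $f$ in $(0,1]$; (2) if $p>a(d-1)$, then $\operatorname{fpt}_{\mathfrak m}(f)<1$, and $\operatorname{fpt}_{\mathfrak m}(f)$ and $1$ are the only $F$-jumping numbers of $f$ in $(0,1]$ (both being $F$-jumping numbers).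
   Context: For an ideal $I\subseteq R$ and $e\ge 0$, $I^{[p^e]}$ is the ideal generated by $\{g^{p^e}: g\in I\}$. Let $\mathscr{B}_e$ be the set of monomials not in $\mathfrak{m}^{[p^e]}$; it is a free basis of $R$ over the subring $R^{p^e}=\mathbb{L}[x_1^{p^e},\dots,x_d^{p^e}]$ of $p^e$-th powers. For $g\in R$ write uniquely $g=\sum_{\mu\in\mathscr{B}_e}\Gamma_\mu^e(g)^{p^e}\mu$ with $\Gamma_\mu^e(g)\in R$, and let $(g)^{[1/p^e]}$ be the ideal generated by all $\Gamma_\mu^e(g)$, $\mu\in\mathscr{B}_e$. For real $\lambda\ge 0$, the ideals $(f^{\lceil p^e\lambda\rceil})^{[1/p^e]}$ increase with $e$, and the test ideal is $\tau(\lambda\bullet f)=\bigcup_{e\ge1}(f^{\lceil p^e\lambda\rceil})^{[1/p^e]}$. The $F$-pure threshold of $f$ at $\mathfrak m$ is $\operatorname{fpt}_{\mathfrak m}(f)=\sup\{\lambda\in\mathbb{R}_{\ge0}:\tau(\lambda\bullet f)_{\mathfrak m}=R_{\mathfrak m}\}$. A real number $\lambda>0$ is an $F$-jumping number of $f$ if $\tau(\lambda\bullet f)\ne\tau((\lambda-\varepsilon)\bullet f)$ for all $0<\varepsilon<\lambda$. *)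

(* Defs.v *)
From HB Require Import structures.
From mathcomp Require Import all_boot all_order all_algebra.
From mathcomp Require Import fraction.
From mathcomp Require Import boolp classical_sets fsbigop reals.
From mathcomp Require Import mpoly.

Set Implicit Arguments.
Unset Strict Implicit.
Unset Printing Implicit Defensive.

Import Order.TTheory GRing.Theory Num.Theory.

Local Open Scope classical_set_scope.
Local Open Scope ring_scope.

(* In characteristic p, a field is perfect when L^p = L. *)
Definition perfect_of_pchar (p : nat) (L : fieldType) : Prop :=
  p \in [pchar L] /\ forall c : L, exists b : L, b ^+ p = c.

Definition ideal_gen (A : comNzRingType) (S : set A) : set A :=
  [set g | exists s : seq (A * A),
     (forall c, c \in s -> S c.2) /\ g = \sum_(c <- s) c.1 * c.2].

(* I^[p^e] *)
Definition frobenius_power (A : comNzRingType) (p e : nat) (I : set A) : set A :=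
  ideal_gen [set g ^+ (p ^ e) | g in I].

Section TestIdeals.
Variables (p d : nat) (L : fieldType).
Local Notation A := {mpoly L[d]}.

Definition max_ideal : set A := ideal_gen [set 'X_i | i in [set: 'I_d]].

(* Monomials are represented by their exponent vectors. *)
Definition monomial_basis (e : nat) : set 'X_{1..d} :=
  [set mu | ~ frobenius_power p e max_ideal 'X_[mu]].

(* \sum_(i \in B) is the finitely supported sum: the set [monomial_basis e] is
   finite when 0 < p.  The values of G outside it are unconstrained. *)
Definition frobenius_expansion (e : nat) (g : A) (G : 'X_{1..d} -> A) : Prop :=
  g = \sum_(mu \in monomial_basis e) G mu ^+ (p ^ e) * 'X_[mu].

(* The expansion exists, and is unique on [monomial_basis e], when L is perfect
   of characteristic p; the default value 0 is then irrelevant. *)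
Definition Gamma (e : nat) (g : A) : 'X_{1..d} -> A :=
  xget (fun=> 0) [set G | frobenius_expansion e g G].

(* (g)^[1/p^e] *)
Definition frobenius_root (e : nat) (g : A) : set A :=
  ideal_gen [set Gamma e g mu | mu in monomial_basis e].

(* I_m and, for I = setT, R_m, as subsets of the fraction field. *)
Definition localization (I : set A) : set {fraction A} :=
  [set x | exists g h : A,
     [/\ I g, ~ max_ideal h & x = tofrac g / tofrac h]].

Variable R : realType.

(* Only used for 0 <= lambda, where the ceiling is a natural number. *)
Definition test_ideal (f : A) (lambda : R) : set A :=
  \bigcup_(e in [set e | (1 <= e)%N])
     frobenius_root e (f ^+ absz (Num.ceil ((p ^ e)%:R * lambda))).

(* [sup] is the actual supremum here for f in max_ideal: the set contains 0 and
   is then bounded above. *)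
Definition fpt (f : A) : R :=
  sup [set lambda : R | 0 <= lambda /\
         localization (test_ideal f lambda) = localization setT].

Definition F_jumping (f : A) (lambda : R) : Prop :=
  0 < lambda /\
  forall eps : R, 0 < eps < lambda ->
    test_ideal f lambda <> test_ideal f (lambda - eps).

End TestIdeals.

Arguments fpt p {d L R} f.
Arguments F_jumping p {d L R} f lambda.

Definition diagonal (d : nat) (L : fieldType) (u : 'I_d -> L) : {mpoly L[d]} :=
  \sum_(i < d) u i *: 'X_i ^+ d.

(* Main.v *)
(** Write [q = p ^ e].  The ideal [(g)^[1/q]] is contained in an ideal [J] as soon
    as [g] is a combination of [q]-th powers of elements of [J], and the
    coefficients of its generators are [q]-th roots of coefficients of [g].  The
    powers of [f] only involve monomials [x^(d k)] with [|k| = N], so bounding the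
    exponents of the generators from below gives upper bounds on test ideals:
    [tau((d omega + 1)/p)] is contained in the maximal ideal, [tau(b)] in its
    square and [tau(1)] in [(f)].  Conversely, if [sum k] is carry-free in base
    [p], the coefficient of [x^(d k)] in [f ^ N] is nonzero by Lucas' theorem, and
    since [f] is homogeneous with exponents in [d Z] and [d] is prime to [p], the
    corresponding generator is a single monomial.  Choosing [k] with prescribed
    top digits shows that [tau] is the unit ideal below [(d omega + 1)/p], hence
    that this number is the threshold, that [tau] contains the maximal ideal below
    [1] when [a (d - 1) < p], and that it contains a variable below [b]
    otherwise. *)

From mathcomp Require Import all_boot all_order all_algebra.
From mathcomp Require Import fraction finmap.
From mathcomp Require Import boolp classical_sets cardinality fsbigop reals.
From mathcomp Require Import mpoly.
From mathcomp Require Import zify lra.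
(* Required last: [classical_sets] also defines a [diagonal]. *)
Require Import Defs.

Set Implicit Arguments.
Unset Strict Implicit.
Unset Printing Implicit Defensive.

Import Order.TTheory GRing.Theory Num.Theory.
Local Open Scope ring_scope.

(** * Ideals as subsets closed under linear combinations *)

Section Ideals.
Variable A : comNzRingType.
Local Open Scope classical_set_scope.
Implicit Types S J : set A.

Definition ideal_closed J : Prop :=
  [/\ J 0, forall x y, J x -> J y -> J (x + y) & forall a x, J x -> J (a * x)].

Lemma ideal_closed_comb J (s : seq (A * A)) :
  ideal_closed J -> (forall c, c \in s -> J c.2) ->
  J (\sum_(c <- s) c.1 * c.2).
Proof.
move=> [J0 JD JM] sJ; rewrite big_seq; elim/big_ind: _ => //.
by move=> c /sJ Jc; apply: JM.
Qed.

Lemma ideal_gen_min S J : ideal_closed J -> S `<=` J -> ideal_gen S `<=` J.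
Proof. by move=> idJ SJ _ [s [sS ->]]; apply: ideal_closed_comb => // c /sS /SJ. Qed.

Lemma ideal_gen_closed S : ideal_closed (ideal_gen S).
Proof.
split=> [|x y [s [sS ->]] [t [tS ->]]|a x [s [sS ->]]].
- by exists [::]; split=> //; rewrite big_nil.
- exists (s ++ t); split; last by rewrite big_cat.
  by move=> c; rewrite mem_cat => /orP[/sS|/tS].
- exists [seq (a * c.1, c.2) | c <- s]; split.
    by move=> c /mapP[c' /sS ? ->].
  by rewrite big_map mulr_sumr; apply: eq_bigr => c _; rewrite mulrA.
Qed.

Lemma sub_ideal_gen S : S `<=` ideal_gen S.
Proof.
move=> x Sx; exists [:: (1, x)]; split; last by rewrite big_seq1 mul1r.
by move=> c; rewrite inE => /eqP->.
Qed.

End Ideals.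

(** * Coefficients of [q]-th powers in characteristic [p] *)

Section FrobeniusCoefficients.
Variables (p e d : nat) (L : fieldType).
Hypothesis pcharL : p \in [pchar L].
Local Notation A := {mpoly L[d]}.
Local Notation q := (p ^ e)%N.
Implicit Types (g h : A) (a m nu : 'X_{1..d}).

Lemma expp_gt0 : (0 < q)%N.
Proof. by rewrite expn_gt0 prime_gt0 // (pcharf_prime pcharL). Qed.

Lemma pnat_pchar_mpoly : ([pchar A]).-nat q.
Proof.
have pA : p \in [pchar A] by rewrite pchar_lalg.
by rewrite (eq_pnat _ (pcharf_eq pA)) pnatX pnat_id ?(pcharf_prime pcharL).
Qed.

Lemma mpoly_frobD g h : (g + h) ^+ q = g ^+ q + h ^+ q.
Proof. exact/exprDn_pchar/pnat_pchar_mpoly. Qed.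

Lemma mpoly_frob0 : (0 : A) ^+ q = 0.
Proof. by rewrite expr0n eqn0Ngt expp_gt0. Qed.

Lemma frob_inj : injective (fun x : L => x ^+ q).
Proof.
move=> x y /= /eqP; rewrite -subr_eq0 => /eqP E.
have pn : ([pchar L]).-nat q.
  by rewrite (eq_pnat _ (pcharf_eq pcharL)) pnatX pnat_id ?(pcharf_prime pcharL).
have /eqP : (x - y) ^+ q = 0.
  apply: (addIr (y ^+ q)); rewrite -exprDn_pchar // subrK add0r.
  by rewrite -(subrK (y ^+ q) (x ^+ q)) E add0r.
by rewrite expf_eq0 => /andP[_]; rewrite subr_eq0 => /eqP.
Qed.

Lemma mpoly_frobE h :
  h ^+ q = \sum_(m <- msupp h) h@_m ^+ q *: 'X_[m *+ q].
Proof.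
rewrite [in LHS](mpolyE h).
rewrite (big_morph (fun g : A => g ^+ q) mpoly_frobD mpoly_frob0).
by apply: eq_bigr => m _; rewrite exprZn mpolyXn.
Qed.

Lemma mulmn_inj m nu : (m *+ q = nu *+ q)%MM -> m = nu.
Proof.
move=> /mnmP E; apply/mnmP => i; move: (E i).
by rewrite !mulmnE => /eqP; rewrite eqn_pmul2r ?expp_gt0 // => /eqP.
Qed.

Lemma mcoeff_frob h nu : (h ^+ q)@_(nu *+ q) = h@_nu ^+ q.
Proof.
rewrite mpoly_frobE raddf_sum /=.
have [nuh|nuh] := boolP (nu \in msupp h).
  rewrite (bigD1_seq nu) ?msupp_uniq //= mcoeffZ mcoeffX eqxx mulr1.
  rewrite big1 ?addr0 // => m /negP mnu; rewrite mcoeffZ mcoeffX.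
  by case: eqP => [/mulmn_inj/eqP//|_]; rewrite mulr0.
rewrite big_seq big1; first by rewrite memN_msupp_eq0 // expr0n eqn0Ngt expp_gt0.
move=> m mh; rewrite mcoeffZ mcoeffX; case: eqP => [/mulmn_inj mnu|_].
  by rewrite -mnu mh in nuh.
by rewrite mulr0.
Qed.

Lemma mcoeff_frob_neq0 h m : (h ^+ q)@_m != 0 -> exists nu, m = (nu *+ q)%MM.
Proof.
rewrite mpoly_frobE raddf_sum /= => /eqP H; apply: contrapT => N; apply: H.
rewrite big1 // => nu _; rewrite mcoeffZ mcoeffX.
by case: eqP => [E|_]; [case: N; exists nu|rewrite mulr0].
Qed.

Lemma mcoeff_frobMX h a m :
  (h ^+ q * 'X_[a])@_m != 0 -> exists nu, m = (nu *+ q + a)%MM.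
Proof.
rewrite mpoly_frobE mulr_suml raddf_sum /= => /eqP H.
apply: contrapT => N; apply: H.
rewrite big1 // => nu _; rewrite -scalerAl -mpolyXD mcoeffZ mcoeffX.
by case: eqP => [E|_]; [case: N; exists nu|rewrite mulr0].
Qed.

(** The splitting step behind Lucas' theorem: by hypothesis no other monomial of [g] reaches this
    exponent after multiplication by a [q]-th power, so a single product contributes. *)
Lemma mcoeff_frobM h g nu a :
    (forall b nu', b \in msupp g ->
       (nu *+ q + a = nu' *+ q + b)%MM -> b = a) ->
  (h ^+ q * g)@_(nu *+ q + a) = h@_nu ^+ q * g@_a.
Proof.
move=> uniq_a; rewrite [in LHS](mpolyE g) mulr_sumr raddf_sum /=.
have term b : (h ^+ q * (g@_b *: 'X_[b]))@_(nu *+ q + a) =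
              g@_b * (h ^+ q * 'X_[b])@_(nu *+ q + a).
  by rewrite -scalerAr mcoeffZ.
have termN b : b \in msupp g -> b != a ->
    (h ^+ q * (g@_b *: 'X_[b]))@_(nu *+ q + a) = 0.
  move=> bg ba; apply/eqP; apply: contraT; rewrite term.
  rewrite mulf_eq0 negb_or => /andP[_ /mcoeff_frobMX [nu' E]].
  by rewrite (uniq_a b nu') ?eqxx in ba.
have [ag|ag] := boolP (a \in msupp g).
  rewrite (bigD1_seq a) ?msupp_uniq //= term addmC mcoeffMX mcoeff_frob mulrC.
  rewrite big_seq_cond big1 ?addr0 // => b /andP[bg ba].
  by rewrite addmC termN.
rewrite (memN_msupp_eq0 ag) mulr0 big_seq big1 // => b bg.
by apply: termN => //; apply: contraNneq ag => <-.
Qed.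

End FrobeniusCoefficients.

(** * Frobenius expansions and the ideals [(g)^[1/q]] *)

Section FrobeniusRoots.
Variables (p e d : nat) (L : fieldType).
Hypothesis perfL : perfect_of_pchar p L.
Local Notation A := {mpoly L[d]}.
Local Notation q := (p ^ e)%N.
Local Notation B := (@monomial_basis p d L e).
Local Open Scope classical_set_scope.
Implicit Types (g h : A) (a m mu nu : 'X_{1..d}) (G : 'X_{1..d} -> A).

Let pcharL : p \in [pchar L]. Proof. by case: perfL. Qed.
Let q_gt0 : (0 < q)%N. Proof. exact: expp_gt0 pcharL. Qed.

(** This set is the [n]-th power of the maximal ideal, described by order of vanishing so that
    membership is read off coefficients. *)
Lemma ideal_closed_mcoeff_lt n :
  ideal_closed [set g : A | forall m, (mdeg m < n)%N -> g@_m = 0].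
Proof.
split=> [m _|x y xJ yJ m mn|a x xJ m mn] /=; first by rewrite mcoeff0.
  by rewrite mcoeffD xJ ?yJ ?addr0.
rewrite mcoeffM big1 // => k /eqP E; rewrite [X in _ * X]xJ ?mulr0 //.
by apply: leq_ltn_trans mn; have := leq_addl (mdeg k.1) (mdeg k.2); rewrite -mdegD -E.
Qed.

Lemma max_idealE : @max_ideal d L = [set g | g@_0 = 0].
Proof.
apply/seteqP; split.
  apply: ideal_gen_min.
    split=> [|x y /= x0 y0|a x /= x0] /=; rewrite ?mcoeff0 //.
      by rewrite mcoeffD x0 y0 addr0.
    by rewrite rmorphM /= x0 mulr0.
  by move=> _ [i _ <-] /=; rewrite mcoeffX mnm1_eq0.
move=> g /= g0; have [I0 ID IM] := ideal_gen_closed [set ('X_i : A) | i in [set: 'I_d]].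
rewrite (mpolyE g) big_seq; elim/big_ind: _ => // m mg.
have [i mi] : exists i, (0 < m i)%N.
  apply: contrapT => N; move: mg; rewrite mcoeff_msupp => /eqP; apply.
  rewrite (_ : m = 0%MM) //; apply/mnmP => i; rewrite mnm0E.
  by apply/eqP; rewrite -leqn0 leqNgt; apply/negP => ?; apply: N; exists i.
have -> : m = (m - U_(i) + U_(i))%MM.
  by rewrite submK //; apply/mnm_lepP => j; rewrite mnm1E; case: eqP => // <-.
by rewrite mpolyXD scalerAl; apply: IM; apply: sub_ideal_gen; exists i.
Qed.

Lemma monomial_basisP mu : B mu <-> forall i, (mu i < q)%N.
Proof.
have [_ _ IM] := ideal_gen_closed [set g ^+ q | g in @max_ideal d L].
split=> [Bmu i|muq].
  rewrite ltnNge; apply/negP => qmu; apply: Bmu.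
  have -> : mu = (mu - U_(i) *+ q + U_(i) *+ q)%MM.
    rewrite submK //; apply/mnm_lepP => j; rewrite mulmnE mnm1E.
    by case: eqP => [<-|]; rewrite ?mul1n.
  rewrite mpolyXD; apply: IM; rewrite -mpolyXn; apply: sub_ideal_gen.
  by exists 'X_i => //; rewrite max_idealE /= mcoeffX mnm1_eq0.
move=> [s [sS E]]; have /eqP : ('X_[mu] : A)@_mu != 0 by rewrite mcoeffX eqxx oner_neq0.
apply; rewrite {}E raddf_sum /= big_seq big1 // => c /sS.
rewrite max_idealE => -[g g0 <-]; rewrite mcoeffM big1 // => k /eqP E.
rewrite [X in _ * X](_ : _ = 0) ?mulr0 //; apply/eqP; apply: contraT => N.
have [nu Enu] := mcoeff_frob_neq0 pcharL N.
have nu0 : nu = 0%MM.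
  apply/mnmP => i; rewrite mnm0E; apply/eqP; move: (muq i).
  move/mnmP/(_ i): E; rewrite mnmDE Enu mulmnE => ->.
  by case: (nu i) => // n; rewrite mulSn; lia.
by move: N; rewrite Enu mcoeff_frob // nu0 g0 expr0n eqn0Ngt q_gt0 eqxx.
Qed.

Lemma finite_monomial_basis : finite_set B.
Proof.
apply: (@sub_finite_set _ _
  [set [multinom (t i : nat) | i < d] | t in [set: {ffun 'I_d -> 'I_q}]]).
  move=> mu /monomial_basisP muq; exists [ffun i => Ordinal (muq i)] => //.
  by apply/mnmP => i; rewrite mnmE ffunE.
exact: finite_image.
Qed.

Lemma frobenius_expansionE g G :
  frobenius_expansion p e g G <->
  g = \sum_(mu <- fset_set B) G mu ^+ q * 'X_[mu].
Proof.
by rewrite /frobenius_expansion fsbig_finite //; exact: finite_monomial_basis.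
Qed.

Lemma mnm_divn_uniq mu mu' nu nu' :
  (forall i, mu i < q)%N -> (forall i, mu' i < q)%N ->
  (nu *+ q + mu = nu' *+ q + mu')%MM -> mu = mu'.
Proof.
move=> h h' /mnmP E; apply/mnmP => i; move: (E i).
rewrite !mnmDE !mulmnE => /(congr1 (modn^~ q)).
by rewrite !modnMDl !modn_small.
Qed.

(** Exponents of basis monomials are remainders modulo [q], so distinct terms of the expansion share
    no monomial. Uniqueness follows by injectivity of Frobenius on [L]. *)
Lemma frobenius_expansion_mcoeff g G mu nu :
  frobenius_expansion p e g G -> B mu ->
  (G mu)@_nu ^+ q = g@_(nu *+ q + mu).
Proof.
move=> /frobenius_expansionE -> Bmu; rewrite raddf_sum /=.
have muB : mu \in fset_set B by rewrite in_fset_set ?inE //; exact: finite_monomial_basis.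
rewrite (bigD1_seq mu) ?fset_uniq //=.
have -> : (G mu ^+ q * 'X_[mu])@_(nu *+ q + mu) = (G mu)@_nu ^+ q.
  by rewrite addmC mcoeffMX mcoeff_frob.
rewrite big_seq_cond big1 ?addr0 // => b /andP[].
rewrite in_fset_set ?inE; last exact: finite_monomial_basis.
move=> Bb bmu; apply/eqP; apply: contraT => /(mcoeff_frobMX pcharL)[nu' E].
rewrite eq_sym in bmu; case/eqP: bmu; apply: mnm_divn_uniq E; exact/monomial_basisP.
Qed.

Lemma frobenius_expansion_uniq g G G' mu :
  frobenius_expansion p e g G -> frobenius_expansion p e g G' -> B mu ->
  G mu = G' mu.
Proof.
move=> gG gG' Bmu; apply/mpolyP => nu; apply: (frob_inj (e:=e) pcharL) => /=.
by rewrite (frobenius_expansion_mcoeff _ gG Bmu) (frobenius_expansion_mcoeff _ gG' Bmu).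
Qed.

Lemma frob_surj (c : L) : exists b, b ^+ q = c.
Proof.
have [_ surj] := perfL; elim: e c => [|n IH] c; first by exists c; rewrite expr1.
have [b bc] := surj c; have [b' b'b] := IH b; exists b'.
by rewrite expnSr exprM b'b.
Qed.

Lemma frobenius_expansionD g h G H :
  frobenius_expansion p e g G -> frobenius_expansion p e h H ->
  frobenius_expansion p e (g + h) (fun mu => G mu + H mu).
Proof.
move=> /frobenius_expansionE gG /frobenius_expansionE hH.
apply/frobenius_expansionE; rewrite {1}gG {1}hH -big_split /=.
by apply: eq_bigr => mu _; rewrite (mpoly_frobD e pcharL) mulrDl.
Qed.

Lemma frobenius_expansion0 : frobenius_expansion p e (0 : A) (fun=> 0).
Proof.
apply/frobenius_expansionE; rewrite big1 // => mu _.
by rewrite (mpoly_frob0 e d pcharL) mul0r.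
Qed.

Lemma frobenius_expansionMr g G h :
  frobenius_expansion p e g G ->
  frobenius_expansion p e (g * h ^+ q) (fun mu => G mu * h).
Proof.
move=> /frobenius_expansionE gG; apply/frobenius_expansionE.
rewrite {1}gG mulr_suml; apply: eq_bigr => mu _.
by rewrite exprMn mulrAC.
Qed.

(** Expansions add, so one monomial suffices: its exponents are divided by [q] with remainder, and
    its coefficient has a [q]-th root because [L] is perfect. *)
Lemma frobenius_expansion_exists g : exists G, frobenius_expansion p e g G.
Proof.
rewrite (mpolyE g); elim/big_ind: _.
- by exists (fun=> 0); apply: frobenius_expansion0.
- move=> x y [G xG] [H yH]; exists (fun mu => G mu + H mu).
  exact: frobenius_expansionD.
move=> m _; have [b bm] := frob_surj g@_m.
pose mu := [multinom (m i %% q)%N | i < d].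
pose nu := [multinom (m i %/ q)%N | i < d].
have Bmu : B mu by apply/monomial_basisP => i; rewrite mnmE ltn_mod.
exists (fun k => if k == mu then b *: 'X_[nu] else 0).
apply/frobenius_expansionE; rewrite (bigD1_seq mu) ?fset_uniq //=; last first.
  by rewrite in_fset_set ?inE //; exact: finite_monomial_basis.
rewrite eqxx big1 => [|k /negPf->]; last by rewrite (mpoly_frob0 e d pcharL) mul0r.
rewrite addr0 exprZn bm mpolyXn -scalerAl -mpolyXD; congr (_ *: 'X_[_]).
by apply/mnmP => i; rewrite mnmDE mulmnE !mnmE -divn_eq.
Qed.

Lemma Gamma_expansion g : frobenius_expansion p e g (Gamma p e g).
Proof. exact: (xgetPex (fun=> 0) (frobenius_expansion_exists g)). Qed.

Lemma Gamma_mcoeff g mu nu : (forall i, mu i < q)%N ->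
  (Gamma p e g mu)@_nu ^+ q = g@_(nu *+ q + mu).
Proof.
move=> /monomial_basisP Bmu.
exact: frobenius_expansion_mcoeff (Gamma_expansion g) Bmu.
Qed.

(** Scaling an expansion of [c.1] by [c.2] expands [c.1 * c.2 ^+ q] with coefficients in [J]; by
    uniqueness the sum of these expansions agrees with [Gamma] on the basis. *)
Lemma frobenius_root_min (J : set A) (s : seq (A * A)) :
  ideal_closed J -> (forall c, c \in s -> J c.2) ->
  frobenius_root p e (\sum_(c <- s) c.1 * c.2 ^+ q) `<=` J.
Proof.
move=> idJ sJ; set g := \sum_(c <- s) _; have [J0 JD JM] := idJ.
suff [G gG GJ] : exists2 G, frobenius_expansion p e g G & forall mu, J (G mu).
  apply: ideal_gen_min => // _ [mu Bmu <-].
  by rewrite (frobenius_expansion_uniq (Gamma_expansion g) gG Bmu).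
rewrite {}/g; elim: s sJ => [|c s IH] sJ.
  by exists (fun=> 0) => //; rewrite big_nil; apply: frobenius_expansion0.
have [|G gG GJ] := IH; first by move=> c' c's; apply: sJ; rewrite inE c's orbT.
have [H cH] := frobenius_expansion_exists c.1.
exists (fun mu => H mu * c.2 + G mu) => [|mu].
  rewrite big_cons; apply: frobenius_expansionD gG.
  exact: frobenius_expansionMr.
by apply: JD => //; apply: JM; apply: sJ; rewrite inE eqxx.
Qed.

Lemma frobenius_root_expand g : exists2 s : seq (A * A),
  (forall c, c \in s -> frobenius_root p e g c.2) &
  g = \sum_(c <- s) c.1 * c.2 ^+ q.
Proof.
exists [seq ('X_[mu], Gamma p e g mu) | mu <- fset_set B].
  move=> c /mapP[mu]; rewrite in_fset_set; last exact: finite_monomial_basis.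
  by rewrite inE => Bmu ->; apply: sub_ideal_gen; exists mu.
rewrite big_map [LHS](proj1 (frobenius_expansionE _ _) (Gamma_expansion g)).
by apply: eq_bigr => mu _; rewrite mulrC.
Qed.

Lemma frobenius_root_closed g : ideal_closed (frobenius_root p e g).
Proof. exact: ideal_gen_closed. Qed.

Lemma frobenius_root_mul g h :
  frobenius_root p e (h * g) `<=` frobenius_root p e g.
Proof.
have [s sg E] := frobenius_root_expand g.
rewrite [X in frobenius_root _ _ (_ * X)]E.
have -> : h * (\sum_(c <- s) c.1 * c.2 ^+ q) =
    \sum_(c <- [seq (h * c.1, c.2) | c <- s]) c.1 * c.2 ^+ q.
  by rewrite big_map mulr_sumr; apply: eq_bigr => c _; rewrite mulrA.
apply: frobenius_root_min; first exact: frobenius_root_closed.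
by move=> c /mapP[c' /sg ? ->].
Qed.

Lemma frobenius_root_expr g (M N : nat) : (M <= N)%N ->
  frobenius_root p e (g ^+ N) `<=` frobenius_root p e (g ^+ M).
Proof. by move=> /subnK <-; rewrite exprD; apply: frobenius_root_mul. Qed.

End FrobeniusRoots.

Section FrobeniusRootTower.
Variables (p d : nat) (L : fieldType).
Hypothesis perfL : perfect_of_pchar p L.
Local Open Scope classical_set_scope.

(** Raising to the power [p ^ n] is additive, so an expression of [g] by [p ^ e]-th powers becomes
    one of [g ^+ (p ^ n)] by [p ^ (n + e)]-th powers of the same elements. *)
Lemma frobenius_root_frob (e n : nat) (g : {mpoly L[d]}) :
  frobenius_root p (n + e) (g ^+ (p ^ n)) `<=` frobenius_root p e g.
Proof.
have pcharL : p \in [pchar L] by case: perfL.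
have [s sg E] := frobenius_root_expand e perfL g.
have -> : g ^+ (p ^ n) =
    \sum_(c <- [seq (c.1 ^+ (p ^ n), c.2) | c <- s]) c.1 * c.2 ^+ (p ^ (n + e)).
  rewrite big_map {1}E.
  rewrite (big_morph (fun g : {mpoly L[d]} => g ^+ _)
             (mpoly_frobD n pcharL) (mpoly_frob0 n d pcharL)).
  by apply: eq_bigr => c _; rewrite exprMn -exprM -expnD addnC.
apply: frobenius_root_min => //; first exact: frobenius_root_closed.
by move=> c /mapP[c' /sg ? ->].
Qed.

End FrobeniusRootTower.

Lemma modn_muln_inj d p x y : coprime d p -> (x < p)%N -> (y < p)%N ->
  (x * d = y * d %[mod p])%N -> x = y.
Proof.
move=> dp; wlog xy : x y / (y <= x)%N => [H xp yp E|xp yp /eqP].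
  by case/orP: (leq_total x y) => xy; [apply/esym|]; apply: H.
rewrite eqn_mod_dvd ?leq_mul // -mulnBl Gauss_dvdl 1?coprime_sym // => pxy.
have : (x - y = 0)%N; last lia.
by apply/eqP; apply: contraTT pxy; rewrite -lt0n => ?; rewrite gtnNdvd //; lia.
Qed.

Lemma mnm_le_mdeg d (m : 'X_{1..d}) i : (m i <= mdeg m)%N.
Proof. by rewrite mdegE (bigD1 i) //= leq_addr. Qed.

(** * Coefficients of powers of the diagonal form *)

Section DiagonalPowers.
Variables (p d : nat) (L : fieldType) (u : 'I_d -> L).
Hypothesis perfL : perfect_of_pchar p L.
Hypothesis d_gt0 : (0 < d)%N.
Hypothesis u_neq0 : forall i, u i != 0.
Local Notation A := {mpoly L[d]}.
Local Notation f := (diagonal u).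
Implicit Types (k t m nu : 'X_{1..d}).

Let pcharL : p \in [pchar L]. Proof. by case: perfL. Qed.
Let p_prime : prime p. Proof. exact: pcharf_prime pcharL. Qed.

Lemma diagonal_exprS N :
  f ^+ N.+1 = \sum_i u i *: (f ^+ N * 'X_[U_(i) *+ d]).
Proof.
by rewrite exprSr mulr_sumr; apply: eq_bigr => i _; rewrite -scalerAr mpolyXn.
Qed.

Lemma diagonal_mcoeff_neq0 N m : (f ^+ N)@_m != 0 ->
  exists2 k, m = (k *+ d)%MM & mdeg k = N.
Proof.
elim: N m => [|N IH] m.
  rewrite expr0 mcoeff1; case: (m =P 0%MM) => [-> _|_]; last by rewrite eqxx.
  exists 0%MM; last exact: mdeg0.
  by apply/mnmP => i; rewrite mulmnE mnm0E.
rewrite diagonal_exprS raddf_sum /= => /eqP H.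
have [i Hi] : exists i, (f ^+ N * 'X_[U_(i) *+ d])@_m != 0.
  apply: contrapT => E; apply: H; rewrite big1 // => i _; rewrite mcoeffZ.
  apply/eqP; rewrite mulf_eq0; apply/orP; right.
  by apply: contraT => ne; case: E; exists i.
move: Hi; rewrite -mcoeff_msupp (perm_mem (msuppMX _ _)) => /mapP[m'].
rewrite mcoeff_msupp => /IH[k -> <-] ->; exists (U_(i) + k)%MM.
  by apply/mnmP => j; rewrite mnmDE !mulmnE mnmDE mulnDl.
by rewrite mdegD mdeg1.
Qed.

(** The multinomial theorem with denominators cleared, so that it makes sense in characteristic [p].
    The induction peels off one factor [f] and uses that the entries of [k] sum to [N.+1]. *)
Lemma diagonal_mcoeff_fact N k : mdeg k = N ->
  (\prod_i (k i)`!)%:R * (f ^+ N)@_(k *+ d) = N`!%:R * \prod_i u i ^+ k i.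
Proof.
elim: N k => [|N IH] k kN.
  have -> : k = 0%MM by apply/eqP; rewrite -mdeg_eq0 kN.
  rewrite expr0 mcoeff1 !big1 ?mul1r; first last.
  - by move=> i _; rewrite mnm0E.
  - by move=> i _; rewrite mnm0E.
  rewrite (_ : (0 *+ d)%MM = 0%MM) ?eqxx //.
  by apply/mnmP => i; rewrite mulmnE mnm0E.
rewrite diagonal_exprS raddf_sum /= mulr_sumr.
transitivity (\sum_i (k i)%:R * (N`!%:R * \prod_j u j ^+ k j)); last first.
  by rewrite -mulr_suml -natr_sum -mdegE kN mulrA -natrM factS.
apply: eq_bigr => i _; rewrite mcoeffZ.
have [ki0|ki_gt0] := posnP (k i).
  rewrite ki0 mul0r [X in _ * (_ * X)](_ : _ = 0) ?mulr0 //.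
  apply/eqP; rewrite mcoeff_eq0 (perm_mem (msuppMX _ _)).
  apply/mapP => -[m _ /mnmP/(_ i)].
  by rewrite mnmDE !mulmnE mnm1E eqxx ki0; lia.
have Ek : k = (U_(i) + (k - U_(i)))%MM.
  rewrite addmC submK //; apply/mnm_lepP => j; rewrite mnm1E.
  by case: eqP => [<-|].
set k' := (k - U_(i))%MM in Ek.
have k'N : mdeg k' = N by move: kN; rewrite Ek mdegD mdeg1 => -[].
have -> : (k *+ d)%MM = (U_(i) *+ d + k' *+ d)%MM.
  by rewrite Ek; apply/mnmP => j; rewrite !(mnmDE, mulmnE) mulnDl.
have k'j j : j != i -> k j = k' j.
  by move=> ji; rewrite Ek mnmDE mnm1E eq_sym (negPf ji).
have k'i : k i = (k' i).+1 by rewrite {1}Ek mnmDE mnm1E eqxx.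
rewrite mcoeffMX.
have E1 : (\prod_j (k j)`! = k i * \prod_j (k' j)`!)%N.
  rewrite (bigD1 i) //= [in RHS](bigD1 i) //= k'i factS -mulnA.
  by congr (_ * (_ * _))%N; apply: eq_bigr => j /k'j->.
have E2 : \prod_j u j ^+ k j = u i * \prod_j u j ^+ k' j.
  rewrite (bigD1 i) //= [in RHS](bigD1 i) //= k'i exprS -mulrA.
  by congr (_ * (_ * _)); apply: eq_bigr => j /k'j->.
rewrite E1 E2 natrM -mulrA; congr (_ * _).
by rewrite mulrCA (IH _ k'N) mulrCA.
Qed.

Lemma fact_natr_neq0 N : (N < p)%N -> N`!%:R != 0 :> L.
Proof.
elim: N => [|N IH] Np; first by rewrite oner_eq0.
rewrite factS natrM mulf_neq0 ?IH 1?ltnW //.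
by rewrite -(dvdn_pcharf pcharL) gtnNdvd.
Qed.

Lemma diagonal_mcoeff_small k : (mdeg k < p)%N ->
  (f ^+ mdeg k)@_(k *+ d) != 0.
Proof.
move=> kp; have := @diagonal_mcoeff_fact _ k erefl.
apply: contra_eq_neq => ->; rewrite mulr0 eq_sym mulf_neq0 ?fact_natr_neq0 //.
by apply/prodf_neq0 => i _; rewrite expf_neq0.
Qed.

(* Lucas' theorem for multinomial coefficients, one base p digit at a time. *)
Lemma diagonal_mcoeff_digit k t : coprime d p ->
  (f ^+ mdeg k)@_(k *+ d) != 0 -> (mdeg t < p)%N ->
  (f ^+ mdeg (k *+ p + t))@_((k *+ p + t) *+ d) != 0.
Proof.
move=> dp k0 tp.
have -> : ((k *+ p + t) *+ d = (k *+ d) *+ (p ^ 1) + t *+ d)%MM.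
  by apply/mnmP => i; rewrite !(mnmDE, mulmnE) expn1 mulnDl mulnAC.
rewrite mdegD mdegMn exprD exprM -[X in _ ^+ X * _](expn1 p).
rewrite mcoeff_frobM // => [|b nu'].
  by rewrite mulf_neq0 ?expf_neq0 // diagonal_mcoeff_small.
(* The entries of [l] and [t] are below [p] and [d] is invertible modulo [p], so residues modulo [p]
   determine the digits. *)
rewrite mcoeff_msupp => /diagonal_mcoeff_neq0[l -> lt] /mnmP E.
congr (_ *+ _)%MM; apply/mnmP => i; move/esym: (E i).
rewrite !(mnmDE, mulmnE) expn1 => /(congr1 (modn^~ p)); rewrite !modnMDl.
apply: (modn_muln_inj dp); last first.
- exact: leq_ltn_trans (mnm_le_mdeg t i) tp.
- by apply: leq_ltn_trans (mnm_le_mdeg l i) _; rewrite lt.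
Qed.

End DiagonalPowers.

(** Serves to pick digits with a prescribed sum under given caps. *)
Lemma mnm_below d (s : 'X_{1..d}) T : (T <= mdeg s)%N ->
  exists2 t : 'X_{1..d}, mdeg t = T & forall i, (t i <= s i)%N.
Proof.
elim: T => [_|T IH Ts]; first by exists 0%MM => [|i]; rewrite ?mdeg0 ?mnm0E.
have [t tT ts] := IH (ltnW Ts).
have [i ti] : exists i, (t i < s i)%N.
  apply: contrapT => N; move: Ts; rewrite -tT ltnNge => /negP; apply.
  rewrite !mdegE; apply: leq_sum => i _; rewrite leqNgt.
  by apply/negP => ?; apply: N; exists i.
exists (U_(i) + t)%MM => [|j]; first by rewrite mdegD mdeg1 tT.
by rewrite mnmDE mnm1E; case: eqP => [<-|_] //=; rewrite add0n.
Qed.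

Lemma mdeg_if d (i0 : 'I_d) x y :
  mdeg [multinom (if i == i0 then x else y) | i < d] = (x + d.-1 * y)%N.
Proof.
rewrite mdegE (bigD1 i0) //= mnmE eqxx; congr (_ + _)%N.
rewrite (eq_bigr (fun=> y)) => [|i /negPf ii0]; last by rewrite mnmE ii0.
by rewrite sum_nat_const cardC1 card_ord.
Qed.

(** * Root ideals of powers of the diagonal form *)

Section DiagonalRoots.
Variables (p d omega a : nat) (L : fieldType) (u : 'I_d -> L).
Hypothesis perfL : perfect_of_pchar p L.
Hypothesis d_ge2 : (2 <= d)%N.
Hypothesis pE : p = (d * omega + a)%N.
Hypothesis omega_gt0 : (0 < omega)%N.
Hypothesis a_lt : (0 < a < d)%N.
Hypothesis u_neq0 : forall i, u i != 0.
Local Notation A := {mpoly L[d]}.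
Local Notation f := (diagonal u).
Local Open Scope classical_set_scope.
Implicit Types (k t m nu mu : 'X_{1..d}).

Let pcharL : p \in [pchar L]. Proof. by case: perfL. Qed.
Let p_prime : prime p. Proof. exact: pcharf_prime pcharL. Qed.
Let d_gt0 : (0 < d)%N. Proof. exact: ltnW. Qed.
Let a_gt0 : (0 < a)%N. Proof. by case/andP: a_lt. Qed.
Let a_ltd : (a < d)%N. Proof. by case/andP: a_lt. Qed.
Let d_ltp : (d < p)%N. Proof. rewrite pE; nia. Qed.

Let coprime_dp : coprime d p.
Proof. by rewrite coprime_sym prime_coprime // gtnNdvd. Qed.

Let coprime_dq e : coprime d (p ^ e).
Proof. by rewrite coprimeXr. Qed.

(** The coefficients of [Gamma] are [q]-th roots of those of [g], so vanishing coefficients of [g]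
    bound the order of every generator. *)
Lemma frobenius_root_order e n (g : A) :
  (forall mu nu, (forall i, mu i < p ^ e)%N -> (mdeg nu < n)%N ->
     g@_(nu *+ (p ^ e) + mu) = 0) ->
  frobenius_root p e g `<=` [set h : A | forall m, (mdeg m < n)%N -> h@_m = 0].
Proof.
move=> g0; apply: ideal_gen_min; first exact: ideal_closed_mcoeff_lt.
move=> _ [mu /(monomial_basisP _ perfL) muq <-] nu nun.
apply: (frob_inj (e := e) pcharL) => /=.
by rewrite Gamma_mcoeff // g0 // expr0n eqn0Ngt (expp_gt0 e pcharL).
Qed.

(** The generator at [mu] is a nonzero scalar times ['X_[nu]]: homogeneity of [f] fixes the degree
    of its monomials, divisibility by [d] fixes their exponents modulo [d], and entries at most
    [1 < d] leave only [nu]. *)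
Lemma frobenius_root_mem e k nu mu :
  (f ^+ mdeg k)@_(k *+ d) != 0 -> (k *+ d = nu *+ (p ^ e) + mu)%MM ->
  (forall i, mu i < p ^ e)%N -> (mdeg nu <= 1)%N ->
  frobenius_root p e (f ^+ mdeg k) 'X_[nu].
Proof.
move=> fk kE muq nu1; set g := f ^+ mdeg k.
have q_gt0 := expp_gt0 e pcharL.
set G := Gamma p e g mu.
have Gnu nu' : G@_nu' ^+ (p ^ e) = g@_(nu' *+ (p ^ e) + mu) by exact: Gamma_mcoeff.
have uniq_nu nu' : G@_nu' != 0 -> nu' = nu.
  move=> H; have {H} : g@_(nu' *+ (p ^ e) + mu) != 0 by rewrite -Gnu expf_neq0.
  move=> /diagonal_mcoeff_neq0[k' kE' k'k].
  have deg_nu : mdeg nu' = mdeg nu.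
    have /eqP := congr1 mdeg kE; have /eqP := congr1 mdeg kE'.
    rewrite !mdegD !mdegMn k'k => /eqP<-.
    by rewrite eqn_add2r eqn_pmul2r // => /eqP.
  have modE i : (nu' i = nu i %[mod d])%N.
    have /mnmP/(_ i) := kE; have /mnmP/(_ i) := kE'.
    rewrite !(mnmDE, mulmnE) => E' E.
    have : (nu' i * p ^ e + mu i = nu i * p ^ e + mu i %[mod d])%N.
      by rewrite E' -E !modnMl.
    move/eqP; rewrite eqn_modDr -(modnMml (nu' i)) -(modnMml (nu i)) => /eqP.
    apply: modn_muln_inj; rewrite ?ltn_mod //.
    by rewrite coprime_sym.
  have small (m : 'X_{1..d}) i : (mdeg m <= 1)%N -> (m i < d)%N.
    by move=> m1; apply: leq_ltn_trans d_ge2; apply: leq_trans (mnm_le_mdeg m i) m1.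
  by apply/mnmP => i; have := modE i; rewrite !modn_small ?small ?deg_nu.
have Gnu0 : G@_nu != 0.
  have : G@_nu ^+ (p ^ e) != 0 by rewrite Gnu -kE.
  by apply: contraNneq => ->; rewrite expr0n eqn0Ngt q_gt0.
have -> : 'X_[nu] = (G@_nu)^-1%:MP * G :> A.
  apply/mpolyP => m; rewrite mcoeffCM mcoeffX; case: eqP => [<-|/eqP ne].
    by rewrite mulVf.
  case: (eqVneq G@_m 0) => [->|/uniq_nu E]; first by rewrite mulr0.
  by rewrite E eqxx in ne.
have [_ _ IM] := frobenius_root_closed p e g.
by apply: IM; apply: sub_ideal_gen; exists mu => //; apply/monomial_basisP.
Qed.

(* The carry-free exponents: the top digit is [K1] at [i0] and [omega]
   elsewhere, and the lower digits add up to [p - 1] in each position. *)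
Lemma carry_free_exponent (i0 : 'I_d) K1 n : (2 <= a)%N ->
  (K1 + d.-1 * omega < p)%N ->
  exists k, [/\ (mdeg k).+1 = (p ^ n.+1 * (K1 + d.-1 * omega).+1)%N,
    (f ^+ mdeg k)@_(k *+ d) != 0, k i0 = (p ^ n.+1 * K1)%N &
    forall j, j != i0 -> (d * k j < p ^ n.+2)%N].
Proof.
move=> a_ge2 Kp.
(* [s] caps the digit following a top digit [omega]: since [p * p = d * omega * p + a * p], such a
   cap keeps [d * k j] below [p ^ 2]. *)
pose s := (p * a %/ d)%N.
have ds : (d * s < p * a)%N.
  rewrite mulnC ltn_neqAle leq_trunc_div andbT.
  apply: contraL (dvdn_mull s (dvdnn d)) => /eqP->.
  by rewrite Gauss_dvdr // gtnNdvd.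
(* The [d - 1] positions other than [i0] can absorb the sum [p - 1] with room to spare: [a >= 2]
   gives [s > 2 p / d - 1], and failure would contradict [d < p]. *)
have ps : (p <= d.-1 * s)%N.
  rewrite leqNgt; apply/negP => sp.
  have sE : (p * a < s.+1 * d)%N by exact: ltn_ceil.
  have h1 : (d.-1 * (p * 2) <= d.-1 * (p * a))%N by rewrite !leq_mul.
  have h2 : (d.-1 * (p * a).+1 <= d.-1 * (s.+1 * d))%N by rewrite leq_mul.
  have h3 : ((d.-1 * s).+1 * d <= p * d)%N by rewrite leq_mul.
  have [D dE] : exists D, d = D.+2 by exists d.-2; lia.
  have h4 : (D * (D + 3) <= D * p)%N by rewrite leq_mul //; lia.
  move: h1 h2 h3 h4; rewrite dE /=; lia.
have [t tp ts] : exists2 t, mdeg t = p.-1 &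
    forall i, (t i <= [multinom (if i == i0 then 0 else s) | i < d] i)%N.
  by apply: mnm_below; rewrite mdeg_if add0n; lia.
(* At [j0] the digit stays strictly under its cap; this position receives all further digits
   [p - 1]. *)
have [j0 j0i0 tj0] : exists2 j0, j0 != i0 & (t j0 < s)%N.
  apply: contrapT => N; move: ps; rewrite leqNgt => /negP; apply.
  rewrite -[X in (X < _)%N]add0n -(mdeg_if i0).
  apply: (@leq_ltn_trans (mdeg t)); last by rewrite tp prednK ?prime_gt0.
  rewrite !mdegE; apply: leq_sum => i _; rewrite mnmE; case: ifP => // /negbT ii0.
  by rewrite leqNgt; apply/negP => ?; apply: N; exists i.
have ti0 : t i0 = 0%N by have := ts i0; rewrite mnmE eqxx leqn0 => /eqP.
pose K := [multinom (if i == i0 then K1 else omega) | i < d].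
have KE : mdeg K = (K1 + d.-1 * omega)%N by exact: mdeg_if.
(* The extra bound at [j0] is an invariant: appending the digit [p - 1] turns [(k j0).+1] into
   [p * (k j0).+1]. *)
suff [k [? ? ? ? _]] : exists k, [/\ (mdeg k).+1 = (p ^ n.+1 * (K1 + d.-1 * omega).+1)%N,
    (f ^+ mdeg k)@_(k *+ d) != 0, k i0 = (p ^ n.+1 * K1)%N,
    forall j, j != i0 -> (d * k j < p ^ n.+2)%N &
    (d * (k j0).+1 <= p ^ n.+2)%N] by exists k.
have pp : (p * p = d * omega * p + a * p)%N by rewrite {1}pE mulnDl.
have p_gt0 := prime_gt0 p_prime.
elim: n => [|n [k [k_deg k_neq0 ki0 kj kj0]]].
  exists (K *+ p + t)%MM; split.
  - by rewrite mdegD mdegMn KE tp expn1; lia.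
  - apply: diagonal_mcoeff_digit => //; last by rewrite tp prednK ?prime_gt0.
    by apply: (diagonal_mcoeff_small perfL) => //; rewrite KE.
  - by rewrite mnmDE mulmnE mnmE eqxx ti0 addn0 expn1 mulnC.
  - move=> j ji0; have := ts j; rewrite mnmE (negPf ji0) => tj.
    have dt : (d * t j <= d * s)%N by rewrite leq_mul.
    rewrite mnmDE mulmnE mnmE (negPf ji0) expnS expn1; lia.
  - have dt : (d * (t j0).+1 <= d * s)%N by rewrite leq_mul.
    rewrite mnmDE mulmnE mnmE (negPf j0i0) expnS expn1; lia.
exists (k *+ p + U_(j0) *+ p.-1)%MM; split.
- rewrite mdegD !mdegMn mdeg1 mul1n expnS -mulnA -k_deg; lia.
- apply: diagonal_mcoeff_digit => //.
  by rewrite mdegMn mdeg1 mul1n prednK.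
- by rewrite mnmDE !mulmnE mnm1E (negPf j0i0) mul0n addn0 ki0 [in RHS]expnS; lia.
- move=> j ji0; rewrite mnmDE !mulmnE mnm1E expnS.
  case: (eqVneq j0 j) => [<-|_].
    have : (p * (d * (k j0).+1) <= p * p ^ n.+2)%N by rewrite leq_mul.
    lia.
  have : (p * (d * k j) < p * p ^ n.+2)%N by rewrite ltn_pmul2l // kj.
  lia.
- rewrite mnmDE !mulmnE mnm1E expnS eqxx.
  have : (p * (d * (k j0).+1) <= p * p ^ n.+2)%N by rewrite leq_mul.
  lia.
Qed.

(** Position [i0] has only zeros after [K1], so [b], the quotient of [d * K1] by [p], is also that
    of [d * k i0] by [p ^ n.+2]; elsewhere the quotient is zero. The value [false] yields the unit
    ideal, [true] a variable. *)
Lemma frobenius_root_mem_exponent (i0 : 'I_d) K1 n (b : bool) : (2 <= a)%N ->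
  (K1 + d.-1 * omega < p)%N -> (b * p < d * K1 < b.+1 * p)%N ->
  frobenius_root p n.+2 (f ^+ (p ^ n.+1 * (K1 + d.-1 * omega).+1).-1)
    'X_[U_(i0) *+ b].
Proof.
move=> a_ge2 Kp /andP[bK Kb].
have [k [k_deg k_neq0 ki0 kj]] := carry_free_exponent i0 n a_ge2 Kp.
rewrite -k_deg /=.
have q_gt0 : (0 < p ^ n.+1)%N by rewrite expn_gt0 prime_gt0.
have qE : (p ^ n.+2 = p * p ^ n.+1)%N by rewrite expnS.
have le_k : (U_(i0) *+ b *+ (p ^ n.+2) <= k *+ d)%MM.
  apply/mnm_lepP => i; rewrite !mulmnE mnm1E qE.
  case: eqP => [<-|_] //; rewrite ki0.
  have : (b * p * p ^ n.+1 <= d * K1 * p ^ n.+1)%N by rewrite leq_mul // ltnW.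
  lia.
apply: (@frobenius_root_mem _ _ _ (k *+ d - U_(i0) *+ b *+ (p ^ n.+2))%MM) => //.
- by rewrite addmC submK.
- move=> i; rewrite mnmBE !mulmnE mnm1E.
  case: (eqVneq i0 i) => [<-|ii0].
    have : (d * K1 * p ^ n.+1 < b.+1 * p * p ^ n.+1)%N by rewrite ltn_pmul2r.
    rewrite ki0 qE; lia.
  by rewrite mulnC !mul0n subn0 kj // eq_sym.
- by rewrite mdegMn mdeg1 mul1n; case: (b).
Qed.

(** Here [p - 1 = d * omega], so the digit [omega] can be used in every position at every level,
    without carries. *)
Lemma frobenius_root_full_a1 n : a = 1%N ->
  frobenius_root p n.+1 (f ^+ (p ^ n * (d * omega).+1).-1) 1.
Proof.
move=> a1; rewrite -mpolyX0.
pose w : 'X_{1..d} := [multinom omega | i < d].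
have w_deg : mdeg w = (d * omega)%N.
  rewrite mdegE (eq_bigr (fun=> omega)) => [|i _]; last by rewrite mnmE.
  by rewrite sum_nat_const card_ord.
have wp : (mdeg w < p)%N by rewrite w_deg pE; lia.
have p_gt0 := prime_gt0 p_prime.
suff [k [k_deg k_neq0 ki]] : exists k, [/\ (mdeg k).+1 = (p ^ n * (d * omega).+1)%N,
    (f ^+ mdeg k)@_(k *+ d) != 0 & forall i, (d * k i < p ^ n.+1)%N].
  rewrite -k_deg; apply: (@frobenius_root_mem _ _ _ (k *+ d)) => //.
  - by apply/mnmP => i; rewrite mnmDE [(0 *+ _)%MM i]mulmnE mnm0E.
  - by move=> i; rewrite mulmnE mulnC.
  - by rewrite mdeg0.
elim: n => [|n [k [k_deg k_neq0 ki]]].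
  exists w; split; first by rewrite mul1n w_deg.
    exact: (diagonal_mcoeff_small perfL).
  by move=> i; rewrite mnmE expn1 pE; lia.
exists (k *+ p + w)%MM; split.
- rewrite mdegD mdegMn w_deg expnS -mulnA -k_deg; lia.
- exact: diagonal_mcoeff_digit.
- move=> i; rewrite mnmDE mulmnE mnmE expnS.
  have : (p * (d * k i).+1 <= p * p ^ n.+1)%N by rewrite leq_mul // ki.
  lia.
Qed.

(** A constant term in a generator would come from a monomial of [f ^+ N] with every [d * k i < p],
    which forces [k i <= omega] and too small a total. *)
Lemma frobenius_root1_sub_max N : (d * omega < N)%N ->
  frobenius_root p 1 (f ^+ N) `<=` @max_ideal d L.
Proof.
move=> N_gt; rewrite max_idealE => g Hg.
apply: (@frobenius_root_order 1 1 (f ^+ N)) Hg _ _; rewrite ?mdeg0 //.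
move=> mu nu mup nu0; apply/eqP; apply: contraT => /diagonal_mcoeff_neq0[k kE kN].
have {nu0} nuE : nu = 0%MM by apply/eqP; rewrite -mdeg_eq0; lia.
have : (N <= d * omega)%N; last lia.
have <- : (\sum_(i < d) omega = d * omega)%N by rewrite sum_nat_const card_ord.
rewrite -kN mdegE; apply: leq_sum => i _.
have := mup i; have /mnmP/(_ i) := kE.
rewrite nuE !(mnmDE, mulmnE, mnm0E) expn1; nia.
Qed.

(** A term of degree at most one allows a single position with [d * k i0 < 2 * p], hence [k i0 < C],
    and at most [omega] elsewhere; the total falls short of [N]. *)
Lemma frobenius_root1_order2 N C : (2 * p <= d * C)%N ->
  (C + d.-1 * omega <= N)%N -> (omega < C)%N ->
  frobenius_root p 1 (f ^+ N) `<=`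
    [set h : A | forall m, (mdeg m < 2)%N -> h@_m = 0].
Proof.
move=> pC N_ge wC; apply: frobenius_root_order => mu nu mup nu2.
apply/eqP; apply: contraT => /diagonal_mcoeff_neq0[k kE kN].
have [i0 nui0] : exists i0, forall j, j != i0 -> nu j = 0%N.
  case: (ltngtP (mdeg nu) 1) => [nu0|ge|/eqP/mdeg1P[i0 /eqP->]].
  - exists (Ordinal d_gt0) => j _; rewrite (_ : nu = 0%MM) ?mnm0E //.
    by apply/eqP; rewrite -mdeg_eq0; lia.
  - by lia.
  - by exists i0 => j; rewrite mnm1E eq_sym => /negPf->.
have nui1 : (nu i0 <= 1)%N.
  by rewrite -ltnS; apply: leq_ltn_trans (mnm_le_mdeg nu i0) nu2.
have : (N <= C.-1 + d.-1 * omega)%N; last lia.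
rewrite -kN -(mdeg_if i0) !mdegE; apply: leq_sum => i _; rewrite mnmE.
have := mup i; have /mnmP/(_ i) := kE; rewrite !(mnmDE, mulmnE) expn1.
case: (eqVneq i i0) => [->|/nui0->]; nia.
Qed.

End DiagonalRoots.

Section CeilNat.
Variable R : realType.

Lemma absz_ceil_le (x : R) n : 0 <= x -> x <= n%:R -> (absz (Num.ceil x) <= n)%N.
Proof.
move=> x0 xn; rewrite -lez_nat gez0_abs ?ceil_le_int ?pmulrn //.
by rewrite ceil_ge0; apply: lt_le_trans x0; rewrite ltrN10.
Qed.

Lemma absz_ceil_ge (x : R) n : n%:R <= x -> (n <= absz (Num.ceil x))%N.
Proof.
move=> nx; have x0 : 0 <= x by apply: le_trans nx.
rewrite -lez_nat gez0_abs; last first.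
  by rewrite ceil_ge0; apply: lt_le_trans x0; rewrite ltrN10.
by rewrite -(ler_int R) -pmulrn; apply: le_trans nx (ceil_ge x).
Qed.

End CeilNat.

(** * General bounds on test ideals, thresholds and jumping numbers *)

Section TestIdealBounds.
Variables (R : realType) (p d : nat) (L : fieldType).
Hypothesis perfL : perfect_of_pchar p L.
Local Open Scope classical_set_scope.
Implicit Types (g : {mpoly L[d]}) (lambda : R).

Let pcharL : p \in [pchar L]. Proof. by case: perfL. Qed.
Let p_prime : prime p. Proof. exact: pcharf_prime pcharL. Qed.
Let p_gt0 : (0 < p)%N. Proof. exact: prime_gt0. Qed.

(** At level [e + 1] the exponent is at least [N * p ^ e], which reduces to exponent [N] at level
    one. *)
Lemma test_ideal_sub g lambda N : N%:R / p%:R <= lambda ->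
  test_ideal p g lambda `<=` frobenius_root p 1 (g ^+ N).
Proof.
move=> Nl x [[|e] //= _ gx].
apply: (frobenius_root_frob perfL (n := e)); rewrite addn1 -exprM.
apply: frobenius_root_expr gx => //; apply: absz_ceil_ge.
move: Nl; rewrite ler_pdivrMr ?ltr0n // => Nl.
by rewrite natrM expnSr natrM mulrC -mulrA ler_wpM2l // mulrC.
Qed.

Lemma frobenius_root_sub_test_ideal g lambda e N : 0 <= lambda ->
  (0 < e)%N -> (p ^ e)%:R * lambda <= N%:R ->
  frobenius_root p e (g ^+ N) `<=` test_ideal p g lambda.
Proof.
move=> l0 e_gt0 lN x gx; exists e => //.
by apply: frobenius_root_expr gx => //; apply: absz_ceil_le; rewrite ?mulr_ge0.
Qed.

(** The exponent on the right is [N] followed by [n + 1] digits [p - 1], the shape of the carry-free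
    construction. The gap [x] is positive, so [p ^ n.+1 * x] reaches one and absorbs the [.-1]. *)
Lemma expn_pred_bound lambda N : lambda < N.+1%:R / p%:R ->
  exists n, (p ^ n.+2)%:R * lambda <= (p ^ n.+1 * N.+1).-1%:R.
Proof.
rewrite ltr_pdivlMr ?ltr0n // -subr_gt0; set x := _ - _ => x_gt0.
have := archi_boundP (ltW (_ : 0 < x^-1)); rewrite invr_gt0 => /(_ x_gt0).
set n := Num.bound _ => xn; exists n.
have np : (n <= p ^ n.+1)%N.
  apply: ltnW; apply: ltn_trans (ltn_expl n (prime_gt1 p_prime)) _.
  by rewrite ltn_exp2l ?prime_gt1.
have : 1 <= (p ^ n.+1)%:R * x.
  apply: (@le_trans _ _ (x^-1 * x)); first by rewrite mulVf ?lt0r_neq0.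
  apply: ler_wpM2r; first exact: ltW.
  by apply: le_trans (ltW xn) _; rewrite ler_nat.
have q_gt0 : (0 < p ^ n.+1 * N.+1)%N by rewrite muln_gt0 expn_gt0 p_gt0.
rewrite -subn1 natrB // (expnS p n.+1) !natrM /x.
by set y : R := (p ^ n.+1)%:R => H; lra.
Qed.

(** At [lambda = 1] the exponent is exactly [q], and [g ^+ q] is the [q]-th power of an element of
    [(g)]. *)
Lemma test_ideal1_sub g : test_ideal p g (1 : R) `<=` [set g * h | h in setT].
Proof.
move=> x [e _]; rewrite mulr1.
have -> : absz (Num.ceil ((p ^ e)%:R : R)) = (p ^ e)%N.
  by apply/eqP; rewrite eqn_leq absz_ceil_le ?absz_ceil_ge.
have {1}-> : g ^+ (p ^ e) = \sum_(c <- [:: (1, g)]) c.1 * c.2 ^+ (p ^ e).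
  by rewrite big_seq1 mul1r.
apply: frobenius_root_min => // [|c]; last first.
  by rewrite inE => /eqP->; exists 1; rewrite ?mulr1.
split=> [|_ _ [h _ <-] [k _ <-]|a _ [h _ <-]]; first by exists 0; rewrite ?mulr0.
  by exists (h + k); rewrite ?mulrDr.
by exists (a * h); rewrite // mulrCA.
Qed.

Lemma ideal_closed_full (J : set {mpoly L[d]}) : ideal_closed J -> J 1 -> J = setT.
Proof.
move=> [_ _ JM] J1; apply/seteqP; split=> // x _.
by rewrite -(mulr1 x); apply: JM.
Qed.

Lemma F_jumping_of_neq g lambda : 0 < lambda ->
  (forall l : R, 0 < l < lambda -> ~ (test_ideal p g l `<=` test_ideal p g lambda)) ->
  F_jumping p g lambda.
Proof.
move=> l0 H; split=> // eps /andP[e0 el] E.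
by apply: (H (lambda - eps)); [apply/andP; split; lra|rewrite -E].
Qed.

(** Without a jump, [g ^+ q.-1] would be a multiple of [g ^+ q] for some [q]; cancelling makes [g] a
    unit, against its zero constant term. *)
Lemma F_jumping1 g : g@_0 = 0 -> g != 0 -> F_jumping p g (1 : R).
Proof.
move=> g0 g_neq0; apply: F_jumping_of_neq => // l /andP[l0 l1] sub_l.
have [n nl] : exists n, (p ^ n.+2)%:R * l <= (p ^ n.+1 * p.-1.+1).-1%:R.
  by apply: expn_pred_bound; rewrite prednK // divff // pnatr_eq0 -lt0n.
move: nl; rewrite prednK // -expnSr => nl.
set q := (p ^ n.+2)%N in nl.
have q_gt0 : (0 < q)%N by rewrite expn_gt0 p_gt0.
have sub_g : frobenius_root p n.+2 (g ^+ q.-1) `<=` [set g * h | h in setT].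
  move=> x gx; apply: test_ideal1_sub; apply: sub_l.
  exact: (frobenius_root_sub_test_ideal (ltW l0) _ nl gx).
have [s sg E] := frobenius_root_expand n.+2 perfL (g ^+ q.-1).
have [h hE] : exists h, g ^+ q.-1 = g ^+ q * h.
  rewrite E big_seq; elim/big_ind: _ => [|_ _ [h ->] [k ->]|c /sg/sub_g [h _ <-]].
  - by exists 0; rewrite mulr0.
  - by exists (h + k); rewrite mulrDr.
  - by exists (c.1 * h ^+ q); rewrite exprMn mulrCA.
have := hE; rewrite -[in RHS](prednK q_gt0) exprSr -mulrA -[LHS]mulr1.
move/(mulfI (expf_neq0 _ g_neq0)) => /(congr1 (mcoeff 0)).
by rewrite mcoeff1 eqxx rmorphM /= g0 mul0r => /eqP; rewrite oner_eq0.
Qed.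

Lemma localization_neq (J : set {mpoly L[d]}) :
  J `<=` @max_ideal d L -> localization J <> localization setT.
Proof.
move=> Jm E; have N1 : ~ @max_ideal d L 1.
  by rewrite max_idealE /= mcoeff1 eqxx => /eqP; rewrite oner_eq0.
have : localization setT (tofrac (1 : {mpoly L[d]}) / tofrac 1) by exists 1, 1.
rewrite -E => -[g [h [/Jm gm hm]]]; rewrite rmorph1 divr1 => Egh.
have h0 : tofrac h != 0.
  rewrite tofrac_eq0; apply/eqP => h0; apply: hm; rewrite h0 max_idealE /=.
  by rewrite mcoeff0.
apply: hm; suff -> : h = g by [].
by apply/eqP; rewrite -tofrac_eq -(mul1r (tofrac h)) Egh divfK.
Qed.

Lemma fpt_eq g (c : R) : 0 < c ->
  (forall l : R, 0 <= l < c -> test_ideal p g l = setT) ->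
  (forall l : R, c <= l -> test_ideal p g l `<=` @max_ideal d L) ->
  fpt p g = c.
Proof.
move=> c_gt0 full small; rewrite /fpt.
set E := [set _ | _].
have -> : E = [set l : R | 0 <= l < c].
  apply/seteqP; split=> l /= => [[l0 lE]|lc].
    by rewrite l0 ltNge; apply/negP => /small/localization_neq.
  by split; [case/andP: lc|rewrite (full l lc)].
have ubE : ubound [set l : R | 0 <= l < c] c by move=> l /andP[_ /ltW].
apply/eqP; rewrite eq_le; apply/andP; split.
  by apply: ge_sup ubE; exists 0; rewrite /= lexx.
rewrite leNgt; apply/negP => lt_c.
set S := sup _ in lt_c.
have S0 : 0 <= S by apply: ub_le_sup; [exists c|rewrite /= lexx].
have : (S + c) / 2 <= S by apply: ub_le_sup; [exists c|apply/andP; split; lra].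
lra.
Qed.

End TestIdealBounds.

(** * Test ideals of the diagonal form *)

Section DiagonalTestIdeals.
Variables (R : realType) (p d omega a : nat) (L : fieldType) (u : 'I_d -> L).
Hypothesis perfL : perfect_of_pchar p L.
Hypothesis d_ge2 : (2 <= d)%N.
Hypothesis pE : p = (d * omega + a)%N.
Hypothesis omega_gt0 : (0 < omega)%N.
Hypothesis a_lt : (0 < a < d)%N.
Hypothesis u_neq0 : forall i, u i != 0.
Local Notation A := {mpoly L[d]}.
Local Notation f := (diagonal u).
Local Open Scope classical_set_scope.
Implicit Types l : R.

Let pcharL : p \in [pchar L]. Proof. by case: perfL. Qed.
Let p_gt0 : (0 < p)%N. Proof. exact/prime_gt0/(pcharf_prime pcharL). Qed.
Let pR_gt0 : 0 < p%:R :> R. Proof. by rewrite ltr0n. Qed.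
Let a_gt0 : (0 < a)%N. Proof. by case/andP: a_lt. Qed.
Let a_ltd : (a < d)%N. Proof. by case/andP: a_lt. Qed.
Let i0 : 'I_d := Ordinal (ltnW d_ge2).
Let omegaE x : (omega + x + d.-1 * omega = d * omega + x)%N.
Proof. by rewrite -{2}(prednK (ltnW d_ge2)) mulSn; lia. Qed.

Lemma diagonal_test_ideal_sub_max l : (d * omega).+1%:R / p%:R <= l ->
  test_ideal p f l `<=` @max_ideal d L.
Proof.
move=> cl x /(test_ideal_sub perfL cl).
exact: (frobenius_root1_sub_max perfL d_ge2 pE omega_gt0 a_lt).
Qed.

Lemma diagonal_test_ideal_full l : 0 <= l < (d * omega).+1%:R / p%:R ->
  test_ideal p f l = setT.
Proof.
move=> /andP[l0 /(expn_pred_bound perfL)[n nl]].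
apply/seteqP; split=> // x _; apply: (frobenius_root_sub_test_ideal perfL l0 _ nl) => //.
rewrite (ideal_closed_full (frobenius_root_closed _ _ _)) //.
case: (ltngtP a 1) => [|a_ge2|a1]; first by lia.
  (* All top digits equal [omega]; as [d * omega < p], the quotient at [i0] is zero. *)
  have := frobenius_root_mem_exponent perfL d_ge2 pE omega_gt0 a_lt u_neq0 i0
    n (K1 := omega) (b := false) a_ge2.
  have := omegaE 0; rewrite !addn0 => ->; rewrite mulm0n mpolyX0; apply; first by lia.
  by apply/andP; split; lia.
exact: (frobenius_root_full_a1 perfL d_ge2 pE omega_gt0 a_lt u_neq0 n.+1 a1).
Qed.

Lemma diagonal_fpt : fpt p f = (d * omega).+1%:R / p%:R :> R.
Proof.
apply: fpt_eq; first by rewrite divr_gt0 ?ltr0n.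
  exact: diagonal_test_ideal_full.
exact: diagonal_test_ideal_sub_max.
Qed.

Lemma diagonal_F_jumping_fpt : F_jumping p f (fpt p f : R).
Proof.
rewrite diagonal_fpt; apply: F_jumping_of_neq; first by rewrite divr_gt0.
move=> l /andP[l0 lc]; rewrite diagonal_test_ideal_full ?lc ?ltW // => H.
have /(diagonal_test_ideal_sub_max (lexx _)) := H 1 I.
by rewrite max_idealE /= mcoeff1 eqxx => /eqP; rewrite oner_eq0.
Qed.

Lemma diagonal_F_jumping1 : F_jumping p f (1 : R).
Proof.
apply: (F_jumping1 R perfL).
  rewrite raddf_sum big1 //= => i _; rewrite mcoeffZ mcoeffXn.
  case: eqP => [/mnmP/(_ i)|_]; last by rewrite mulr0.
  by rewrite mulmnE mnm1E eqxx mnm0E; lia.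
have k1 : mdeg (U_(i0) : 'X_{1..d})%MM = 1%N by rewrite mdeg1.
have := @diagonal_mcoeff_small p d L u perfL (ltnW d_ge2) u_neq0 U_(i0)%MM.
rewrite k1 expr1 => /(_ (prime_gt1 (pcharf_prime pcharL))).
by apply: contraNneq => ->; rewrite mcoeff0.
Qed.

Lemma diagonal_test_ideal_max l : (2 <= a)%N -> (a * (d - 1) < p)%N ->
  (d * omega).+1%:R / p%:R <= l < 1 -> test_ideal p f l = @max_ideal d L.
Proof.
move=> a_ge2 ap /andP[cl l1]; apply/seteqP; split.
  exact: diagonal_test_ideal_sub_max.
have l0 : 0 <= l by apply: le_trans cl; rewrite divr_ge0.
have [n nl] : exists n, (p ^ n.+2)%:R * l <= (p ^ n.+1 * p.-1.+1).-1%:R.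
  by apply: (expn_pred_bound perfL); rewrite prednK // divff // lt0r_neq0.
set g := f ^+ (p ^ n.+1 * p.-1.+1).-1.
apply: (@subset_trans _ (frobenius_root p n.+2 g)); last first.
  exact: (frobenius_root_sub_test_ideal perfL l0 _ nl).
apply: ideal_gen_min; first exact: frobenius_root_closed.
move=> _ [i _ <-].
(* The top digit [omega + a.-1] brings the digit sum to [p - 1]. From [2 <= a < d], [d * K1] exceeds
   [p], and [a * (d - 1) < p] keeps it below [2 * p]. *)
have := frobenius_root_mem_exponent perfL d_ge2 pE omega_gt0 a_lt u_neq0 i
    n (K1 := (omega + a.-1)%N) (b := true) a_ge2.
rewrite omegaE mulm1n (_ : (d * omega + a.-1 = p.-1)%N); last by rewrite pE; lia.
apply; first by rewrite prednK.
have h : (d * a.-1 < d * omega + 2 * a)%N.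
  have : (a * (d - 1) = d * a.-1 + d - a)%N by rewrite mulnBr -subn1 mulnBr; nia.
  lia.
have h' : (d * 1 <= d * a.-1)%N by rewrite leq_mul //; lia.
apply/andP; split; lia.
Qed.

(** The two inequalities on [d * n] encode that [n] is the ceiling of [2 a / d], and
    [omega + n <= a] says that the candidate is at most one. *)
Lemma diagonal_F_jumping_second n : (2 <= a)%N ->
  (2 * a <= d * n)%N -> (d * n.-1 < 2 * a)%N -> (omega + n <= a)%N ->
  F_jumping p f (((d + 1) * omega + n)%:R / p%:R : R).
Proof.
move=> a_ge2 n_ge n_le na.
have n_gt0 : (0 < n)%N by case: n n_ge {n_le na} => //; lia.
have NE : ((d + 1) * omega + n = (2 * omega + n).-1 + d.-1 * omega + 1)%N.
  by rewrite -[in LHS](prednK (ltnW d_ge2)); lia.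
apply: F_jumping_of_neq; first by rewrite divr_gt0 // ltr0n; lia.
move=> l /andP[l0 lb] sub_l.
move: lb; rewrite {1}NE addn1 => /(expn_pred_bound perfL)[m ml].
(* This [K1] is the largest top digit with [d * K1 < 2 * p]; its successor is the [C] of the order
   bound below. *)
have := frobenius_root_mem_exponent perfL d_ge2 pE omega_gt0 a_lt u_neq0 i0
    m (K1 := (2 * omega + n).-1) (b := true) a_ge2.
have dn : (d * (2 * omega + n).-1 = 2 * (d * omega) + d * n.-1)%N.
  by rewrite -(prednK n_gt0) addnS /=; lia.
rewrite mulm1n => mem_root.
have /sub_l : test_ideal p f l 'X_i0.
  apply: (frobenius_root_sub_test_ideal perfL (ltW l0) _ ml) => //.
  apply: mem_root; first by rewrite -ltnS -[X in (X < _)%N]addn1 -NE; lia.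
  have : (d * 1 <= d * omega)%N by rewrite leq_mul.
  move=> dw; apply/andP; split; lia.
move=> /(test_ideal_sub perfL (lexx _)).
have order2 := frobenius_root1_order2 (u := u) perfL d_ge2 pE omega_gt0 a_lt
  (N := ((d + 1) * omega + n)%N) (C := (2 * omega + n)%N).
have {}/order2 H2 : (2 * p <= d * (2 * omega + n))%N by lia.
have {}/H2 H2 : (2 * omega + n + d.-1 * omega <= (d + 1) * omega + n)%N by lia.
have {}/H2 H2 : (omega < 2 * omega + n)%N by lia.
move=> /H2 /(_ U_(i0)%MM).
by rewrite mdeg1 mcoeffXU eqxx => /(_ isT) /eqP; rewrite oner_eq0.
Qed.

End DiagonalTestIdeals.

(** * The rounded constant and the final case analysis *)

Lemma absz_ceil_ratio (R : realType) (m d : nat) : (0 < d)%N -> (0 < m)%N ->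
  exists n : nat, [/\ Num.ceil (m%:R / d%:R : R) = n%:Z,
    (m <= d * n)%N & (d * n.-1 < m)%N].
Proof.
move=> d_gt0 m_gt0; set x : R := _ / _.
have dR : 0 < d%:R :> R by rewrite ltr0n.
have x_gt0 : 0 < x by rewrite divr_gt0 // ltr0n.
have c_gt0 : 0 < Num.ceil x by rewrite ceil_gt0.
exists (absz (Num.ceil x)); rewrite gez0_abs ?ltW //.
set n := absz _; have nE : Num.ceil x = n%:Z by rewrite /n gez0_abs ?ltW.
have n_gt0 : (0 < n)%N by rewrite -ltz_nat -nE.
have := ceil_itv x; rewrite nE => /andP[lo hi]; split=> //.
  by rewrite -(ler_nat R) natrM -ler_pdivrMl // mulrC.
rewrite -(ltr_nat R) natrM -ltr_pdivlMl // [X in _ < X]mulrC -/x.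
by move: lo; rewrite -subn1 natrB // intrB.
Qed.

Theorem theorem3p6 (R : realType) (p d omega a : nat) (L : fieldType)
    (u : 'I_d -> L) :
  prime p -> (2 <= d)%N -> (d < p)%N ->
  p = (d * omega + a)%N -> (1 <= omega)%N -> (1 <= a < d)%N ->
  perfect_of_pchar p L ->
  (forall i, u i != 0) ->
  let f : {mpoly L[d]} := diagonal u in
  let c : R := fpt p f in
  let b : R := (((d + 1) * omega)%:R + (Num.ceil ((2 * a)%:R / d%:R : R))%:~R)
               / p%:R in
  (a = 1%N -> c = 1) /\
  ((2 <= a)%N ->
     ((p < a * (d - 1))%N ->
        [/\ c < b, b <= 1,
            F_jumping p f c, F_jumping p f b & F_jumping p f (1 : R)]) /\
     ((a * (d - 1) < p)%N ->
        [/\ c < 1, F_jumping p f c, F_jumping p f (1 : R) &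
            forall lambda : R, 0 < lambda <= 1 -> F_jumping p f lambda ->
              lambda = c \/ lambda = 1])).
Proof.
move=> p_prime d_ge2 d_ltp pE w_gt0 a_lt perfL u_neq0 f c b.
have [a_gt0 a_ltd] : (0 < a)%N /\ (a < d)%N by case/andP: a_lt.
have pR_gt0 : 0 < p%:R :> R by rewrite ltr0n prime_gt0.
have cE : c = (d * omega).+1%:R / p%:R.
  exact: (diagonal_fpt R perfL d_ge2 pE w_gt0 a_lt u_neq0).
have jump_c : F_jumping p f c.
  exact: (diagonal_F_jumping_fpt R perfL d_ge2 pE w_gt0 a_lt u_neq0).
have jump_1 : F_jumping p f (1 : R).
  exact: (diagonal_F_jumping1 R perfL d_ge2 pE w_gt0 a_lt u_neq0).
have c_lt1 : (2 <= a)%N -> c < 1.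
  by move=> ?; rewrite cE ltr_pdivrMr // mul1r ltr_nat; lia.
split=> [a1|a_ge2].
  by rewrite cE (_ : (d * omega).+1 = p) ?divff ?lt0r_neq0 //; lia.
split=> pa.
  have [n [nE n_ge n_le]] :=
    @absz_ceil_ratio R (2 * a) d (ltnW d_ge2) (ltac:(by rewrite muln_gt0)).
  have bE : b = ((d + 1) * omega + n)%:R / p%:R by rewrite /b nE natrD.
  have n_gt0 : (0 < n)%N by case: n n_ge {n_le nE bE} => //; lia.
  (* The hypothesis [p < a * (d - 1)] reads [d * omega + 2 * a < d * a], to be combined with
     [d * n.-1 < 2 * a]. *)
  have wn : (omega + n <= a)%N.
    have : (d * (omega + n.-1) < d * a)%N.
      have : (a * (d - 1) = d * a - a)%N by rewrite mulnBr muln1 mulnC.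
      lia.
    by rewrite ltn_pmul2l; lia.
  have dw : (d * omega + omega = (d + 1) * omega)%N by rewrite mulnDl mul1n.
  split=> //.
  - by rewrite cE bE ltr_pM2r ?invr_gt0 // ltr_nat; lia.
  - by rewrite bE ler_pdivrMr // mul1r ler_nat; lia.
  - rewrite bE; exact: (diagonal_F_jumping_second R perfL d_ge2 pE w_gt0 a_lt u_neq0).
split=> //; first exact: c_lt1.
move=> l /andP[l_gt0 l_le1] [_ jump_l].
have [l_lt1|l_ge1] := ltP l 1; last by right; apply/eqP; rewrite eq_le l_le1.
left; case: (ltgtP l c) => // lc.
  (* Below [c] the test ideals at [l] and [l / 2] are both the whole ring. *)
  case: (jump_l (l / 2)); first by apply/andP; split; lra.
  rewrite !(diagonal_test_ideal_full perfL d_ge2 pE w_gt0 a_lt u_neq0) // -cE;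
    by apply/andP; split; lra.
(* Between [c] and one, this choice of [eps] compares [l] with [c], and both test ideals are the
   maximal ideal. *)
case: (jump_l (l - c)); first by apply/andP; split; have := jump_c.1; lra.
have -> : l - (l - c) = c by lra.
rewrite !(diagonal_test_ideal_max perfL d_ge2 pE w_gt0 a_lt u_neq0) // -cE ?lexx ?c_lt1 //.
by rewrite ltW.
Qed.
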